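(* There exist constants $\hat\delta>0$ and $\hat C$, which may depend on $\phi$ and its derivatives and on $F$ but not on $\varepsilon$, such that, if $\delta\le\hat\delta$, then $$\inf_{\substack{u\in\mathcal{U}\\ \|u'\|_{\ell^2_\varepsilon}=1}}\mathcal{E}_{\rm qce}''(y_{{\rm qce},F})[u,u]\;\le\;\phi_F''\Big(\min\{m_+,\,m_-,\,m_0\}+\hat C\,\delta^2\Big),$$ where $$m_\pm=1+\frac{3\phi_{2F}''}{\phi_F''}\pm\Big(\frac{\phi_F'''\,\phi_{2F}'}{2|\phi_F''|^2}-\frac32\,\frac{\phi_{2F}''}{\phi_F''}\Big),\qquad m_0=\frac{A_F}{\phi_F''},\qquad A_F=\phi_F''+4\phi_{2F}''.$$
   Context: Let $N\in\mathbb{N}$, $\varepsilon=1/N$, and let $K$ be an integer with $1<K\le N-2$. The interaction potential $\phi$ satisfies: (i) $\phi\in C^4((0,\infty);\mathbb{R})$; (ii) there is $r_*>0$ such that $\phi$ is convex in $(0,r_* )$ and concave in $(r_*,\infty)$; (iii) $\phi^{(k)}(r)\to0$ rapidly as $r\to\infty$ for $k=0,\dots,4$. Throughout, $F>0$ with $F\ge r_*/2$ (so $\phi''(2F)\le0$), and $\phi''(F)>0$. Notation: $\phi_G'=\phi'(G)$, $\phi_G''=\phi''(G)$, $\phi_G'''=\phi'''(G)$. For a sequence $v=(v_\ell)_{\ell\in\mathbb{Z}}$ write $v_\ell'=\varepsilon^{-1}(v_\ell-v_{\ell-1})$. Let $\mathcal{U}$ be the space of real sequences $u=(u_\ell)_{\ell\in\mathbb{Z}}$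 with $u_{\ell+2N}=u_\ell$ for all $\ell$ and $\sum_{\ell=-N+1}^N u_\ell=0$. Let $y_F=(F\ell\varepsilon)_{\ell\in\mathbb{Z}}$ and $\mathcal{Y}_F=\{y_F+u:u\in\mathcal{U}\}$. For $2N$-periodic $v$, $\|v\|_{\ell^2_\varepsilon}=\big(\varepsilon\sum_{\ell=-N+1}^N|v_\ell|^2\big)^{1/2}$ and $\|v\|_{\ell^\infty}=\max_{-N+1\le\ell\le N}|v_\ell|$. The energy-based quasicontinuum (QCE) energy, with $\mathcal{A}=\{-K,\dots,K\}$ and $\mathcal{C}=\{-N+1,\dots,N\}\setminus\mathcal{A}$, is $$\mathcal{E}_{\rm qce}(y)=\varepsilon\sum_{\ell\in\mathcal{C}}E^c_\ell(y)+\varepsilon\sum_{\ell\in\mathcal{A}}E^a_\ell(y),$$ $$E^a_\ell(y)=\tfrac12\big[\phi(y_\ell')+\phi(y_{\ell+1}')+\phi(y_{\ell-1}'+y_\ell')+\phi(y_{\ell+1}'+y_{\ell+2}')\big],\quad E^c_\ell(y)=\tfrac12\big[\phi(y_\ell')+\phi(y_{\ell+1}')+\phi(2y_\ell')+\phi(2y_{\ell+1}')\big],$$ for $y\in\mathcal{Y}_F$ with all $y_\ell'>0$. $\mathcal{E}_{\rm qce}'(y)[u]$ and $\mathcal{E}_{\rm qce}''(y)[u,v]$ denote its first and second variations in directions $u,v\in\mathcal{U}$. Small parameters: $\delta_1=\phi_{2F}'/\phi_F''$, $\delta_2=-\phi_{2F}''/\phi_F''$, $\delta_3=\phi_{2F}'''/\phi_F''$,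 and $\delta=\max(|\delta_1|,|\delta_2|,|\delta_3|)$. Let $\hat g\in\mathcal{U}$ be defined by $\hat g_\ell'=-\tfrac12$ for $\ell\in\{-K-1,K+2\}$, $\hat g_\ell'=\tfrac12$ for $\ell\in\{-K+1,K\}$, and $\hat g_\ell'=0$ for all other $\ell\in\{-N+1,\dots,N\}$ (extended $2N$-periodically), and let $\hat y_{{\rm qce},F}=y_F+\delta_1\hat g$. For $\delta_1,\delta_2$ sufficiently small, $y_{{\rm qce},F}\in\mathcal{Y}_F$ denotes the (locally unique) solution of $\mathcal{E}_{\rm qce}'(y_{{\rm qce},F})[u]=0$ for all $u\in\mathcal{U}$ that satisfies $\|(y_{{\rm qce},F}-\hat y_{{\rm qce},F})'\|_{\ell^\infty}\le C(\delta_1^2+\delta_1\delta_2)$, with $C$ depending possibly on $\phi$, its derivatives and $F$ but not on $\varepsilon$. *)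

(* Defs.v *)
From mathcomp Require Import all_boot all_order all_algebra.
From mathcomp Require Import all_classical all_reals all_analysis.
Set Implicit Arguments.
Unset Strict Implicit.
Unset Printing Implicit Defensive.
Import Order.TTheory GRing.Theory Num.Theory.
Import numFieldNormedType.Exports.
Local Open Scope classical_set_scope.
Local Open Scope ring_scope.

Section Lattice.
Variable R : realType.
Implicit Types (N K : nat) (F : R) (u v y g : int -> R) (l : int).

Definition eps N : R := N%:R^-1.

(* v'_l = (v_l - v_{l-1}) / eps *)
Definition dq N v : int -> R := fun l => (eps N)^-1 * (v l - v (l - 1)).

(* The period cell -N+1, ..., N. *)
Definition cell N : seq int := [seq i%:Z - N%:Z + 1 | i <- iota 0 N.*2].

Definition Uspace N : set (int -> R) :=
  [set u | (forall l, u (l + N.*2%:Z) = u l) /\ \sum_(l <- cell N) u l = 0].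

Definition yhom F N : int -> R := fun l => F * l%:~R * eps N.

Definition YF F N : set (int -> R) :=
  [set y | exists2 u, Uspace N u & forall l, y l = yhom F N l + u l].

Definition l2norm N v : R := Num.sqrt (eps N * \sum_(l <- cell N) `|v l| ^+ 2).

(* The maximum is over nonnegative numbers, so the default value 0 is harmless. *)
Definition linfnorm N v : R := \big[Num.max/0]_(l <- cell N) `|v l|.

End Lattice.

Section Energy.
Variables (R : realType) (phi : R -> R).
Implicit Types (N K : nat) (u v y : int -> R) (l : int).

Definition Eatom N y l : R :=
  2^-1 * (phi (dq N y l) + phi (dq N y (l + 1))
          + phi (dq N y (l - 1) + dq N y l)
          + phi (dq N y (l + 1) + dq N y (l + 2))).

Definition Econt N y l : R :=
  2^-1 * (phi (dq N y l) + phi (dq N y (l + 1))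
          + phi (2 * dq N y l) + phi (2 * dq N y (l + 1))).

Definition Eqce N K y : R :=
  eps R N * (\sum_(l <- cell N | (K < `|l|)%N) Econt N y l)
  + eps R N * (\sum_(l <- cell N | (`|l| <= K)%N) Eatom N y l).

Definition dEqce N K y u : R :=
  derive1 (fun t : R => Eqce N K (fun l => y l + t * u l)) 0.

Definition ddEqce N K y u v : R :=
  derive1 (fun t : R => dEqce N K (fun l => y l + t * v l) u) 0.

End Energy.

Section Potential.
Variables (R : realType) (phi : R -> R).
Implicit Types (rstar F : R).

(* phi is only meaningful on (0, +oo); its values elsewhere are unconstrained. *)
Definition C4_pos : Prop :=
  forall r : R, 0 < r ->
    (forall k, (k < 4)%N -> derivable (phi^`(k)%classic) r 1)
    /\ {for r, continuous (phi^`(4)%classic)}.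

Definition interaction_potential rstar : Prop :=
  [/\ C4_pos,
      0 < rstar,
      @convex_function R R^o [set r | 0 < r < rstar] phi,
      @convex_function R R^o [set r | rstar < r] (fun r => - phi r)
    & forall k, (k <= 4)%N -> phi^`(k)%classic r @[r --> +oo] --> (0 : R)].

Definition admissible rstar F : Prop :=
  [/\ interaction_potential rstar, 0 < F, rstar / 2 <= F & 0 < phi^`(2)%classic F].

(* The quantity through which constants may depend on phi.  For an admissible
   phi the derivatives are continuous on [F/2, +oo) and vanish at infinity, so
   some M always works. *)
Definition derivatives_bounded_by (M F : R) : Prop :=
  forall k r, (k <= 4)%N -> F / 2 <= r -> `|phi^`(k)%classic r| <= M * phi^`(2)%classic F.

Variable F : R.

Definition delta1 : R := phi^`(1)%classic (2 * F) / phi^`(2)%classic F.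
Definition delta2 : R := - phi^`(2)%classic (2 * F) / phi^`(2)%classic F.
Definition delta3 : R := phi^`(3)%classic (2 * F) / phi^`(2)%classic F.
Definition delta : R := Num.max (Num.max `|delta1| `|delta2|) `|delta3|.

Definition AF : R := phi^`(2)%classic F + 4 * phi^`(2)%classic (2 * F).

Definition m_corr : R :=
  phi^`(3)%classic F * phi^`(1)%classic (2 * F) / (2 * `|phi^`(2)%classic F| ^+ 2)
  - 3 / 2 * (phi^`(2)%classic (2 * F) / phi^`(2)%classic F).
Definition m_plus : R := 1 + 3 * phi^`(2)%classic (2 * F) / phi^`(2)%classic F + m_corr.
Definition m_minus : R := 1 + 3 * phi^`(2)%classic (2 * F) / phi^`(2)%classic F - m_corr.
Definition m_zero : R := AF / phi^`(2)%classic F.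

End Potential.

Section Equilibrium.
Variables (R : realType) (phi : R -> R) (F : R) (N K : nat).
Implicit Types (g y u : int -> R).

(* These conditions determine g uniquely when 1 < K <= N - 2. *)
Definition is_ghat g : Prop :=
  Uspace N g /\
  forall l : int, l \in cell N ->
    dq N g l = if l \in [:: - K%:Z - 1; K%:Z + 2] then - 2^-1
               else if l \in [:: - K%:Z + 1; K%:Z] then 2^-1
               else 0.

Definition yhat_qce g : int -> R := fun l => yhom F N l + delta1 phi F * g l.

Definition is_yqce (C : R) g y : Prop :=
  [/\ YF F N y,
      forall l, 0 < dq N y l,
      forall u, Uspace N u -> dEqce phi N K y u = 0
    & linfnorm N (dq N (fun l => y l - yhat_qce g l))
        <= C * (delta1 phi F ^+ 2 + delta1 phi F * delta2 phi F)].

Definition qce_coercivity y : \bar R :=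
  ereal_inf [set (ddEqce phi N K y u u)%:E
            | u in [set u | Uspace N u /\ l2norm N (dq N u) = 1]].

End Equilibrium.

(* Main.v *)
Require Import Defs.
From mathcomp Require Import all_boot all_order all_algebra.
From mathcomp Require Import all_classical all_reals all_analysis.
From mathcomp Require Import zify ring lra.
Import Order.TTheory GRing.Theory Num.Theory.
Import numFieldNormedType.Exports.
Local Open Scope classical_set_scope.
Local Open Scope ring_scope.

(** The smallest eigenvalue is bounded above by the second variation in any
    admissible direction of unit norm, so three test directions suffice, one for
    each of m_plus, m_minus and m_zero.

    Summing by parts, the energy becomes a sum over bonds [Eqce_bonds]: bond l
    carries phi (y'_l), with y' the strain, then phi (2 y'_l) with a weight
    counting the continuum sites at its two ends, and phi (y'_l + y'_(l+1)) with
    a weight counting the atomistic sites l+1 and l-1, the two whose site energy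
    contains that pair.  The k-th variation in a fixed direction is then the
    same sum with the k-th derivative of phi and the k-th power of the strain of
    the direction [ddEqceE].

    The test directions have strain +c on bond 1-m, -c on bond m and 0 elsewhere
    in the period cell: they are constant on the sites of modulus less than m,
    and on the remaining ones.  There is no interaction between the two strained
    bonds, so the second variation is the mean of their two diagonal
    coefficients [bond_variation_test_le].  The coefficient of a bond is
    phi'' (y'_l) plus n times phi''(2F), up to errors, where n is its total
    second-neighbour weight:
     - m = K: both bonds have y' = F + delta1/2 and n = 3/2, which is m_plus;
     - m = K+2: both have y' = F - delta1/2 and n = 9/2, which is m_minus;
     - m = N: if K+2 < N both lie in the pure continuum, where y' = F and n = 4,
       which is m_zero.

    These values of y' are exact up to C (delta1^2 + delta1 delta2), so a Taylor
    expansion of phi'' at F and at 2F, with the fourth derivative bounded by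
    M phi''(F), makes each error O(delta^2) with a constant depending on M and C
    only; at 2F the linear term is itself O(delta^2) because phi'''(2F) is
    delta3 phi''(F) [phi2_bond_le, phi2_pair_le].

    When K+2 = N the last direction is not available.  If delta > 0 a constant
    depending on phi absorbs the gap between m_plus and the minimum, and if
    delta = 0 then m_plus, m_minus and m_zero are all 1. *)

Set Implicit Arguments.
Unset Strict Implicit.
Unset Printing Implicit Defensive.

(** * The energy as a sum over bonds *)

Section Cell.
Variable R : realType.
Implicit Types (N K m : nat) (l : int).

Lemma mem_cell N l : (l \in cell N) = (1 - N%:Z <= l <= N%:Z).
Proof.
apply/mapP/idP => [[i]|hl]; first by rewrite mem_iota => /andP[_ hi] ->; lia.
by exists `|(l + N%:Z - 1)%R|%N; rewrite ?mem_iota; lia.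
Qed.

Lemma cell_uniq N : uniq (cell N).
Proof. by rewrite map_inj_uniq ?iota_uniq // => i j; lia. Qed.

Lemma cell_telescope (T : int -> R) N :
  \sum_(l <- cell N) (T (l + 1) - T l) = T (N%:Z + 1) - T (1 - N%:Z).
Proof.
rewrite big_map.
pose f (i : nat) := T (i%:Z - N%:Z + 1).
have := telescope_sumr f (leq0n N.*2).
rewrite /index_iota subn0 /f => {f}.
have -> : (N.*2%:Z - N%:Z + 1 : int) = N%:Z + 1 by lia.
have -> : (0%:Z - N%:Z + 1 : int) = 1 - N%:Z by lia.
move=> <-; apply: eq_bigr => i _; congr (T _ - T _); lia.
Qed.

Lemma periodicP N (T : eqType) (f : int -> T) :
  (0 < N)%N -> (forall l, f (l + N.*2%:Z) = f l) ->
  forall P : T -> Prop,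
  (forall l, l \in cell N -> P (f l)) -> forall l, P (f l).
Proof.
move=> N0 fper P Pcell l.
have fpern k i : f (i + k%:Z * N.*2%:Z) = f i.
  elim: k => [|k IH] in i *; first by congr f; lia.
  by rewrite -[RHS]fper -[RHS]IH; congr f; lia.
pose r := ((l + N%:Z - 1) %% N.*2%:Z)%Z.
have r0 : 0 <= r by rewrite modz_ge0 //; lia.
have r1 : r < N.*2%:Z by rewrite ltz_pmod //; lia.
have dl := divz_eq (l + N%:Z - 1) N.*2%:Z; rewrite -/r in dl.
have -> : f l = f (r - N%:Z + 1).
  case: (_ %/ _)%Z dl => q dl.
    by rewrite -[RHS](fpern q); congr f; lia.
  by rewrite -[LHS](fpern q.+1); congr f; lia.
by apply: Pcell; rewrite mem_cell; lia.
Qed.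

(** Indicator of the atomistic region.  The sites -N-1, -N and N+1 are the only
    ones outside the period cell at which it is evaluated; its value 0 there is
    also that of its periodic extension, because K <= N - 2. *)
Definition core K l : R := (`|l| <= K)%N%:R.

Lemma core_out K l : (K < `|l|)%N -> core K l = 0.
Proof. by move=> Kl; rewrite /core leqNgt Kl. Qed.

Lemma core_in K l : (`|l| <= K)%N -> core K l = 1.
Proof. by rewrite /core => ->. Qed.

Definition cont_weight K l : R := 2^-1 * ((1 - core K l) + (1 - core K (l - 1))).
Definition atom_weight K l : R := 2^-1 * (core K (l + 1) + core K (l - 1)).

Definition strain_periodic N (y : int -> R) :=
  forall l, dq N y (l + N.*2%:Z) = dq N y l.

(** The site energies and the bond energies differ by the increments of a
    function T of the bond.  These add up to 0 since the strains are periodic and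
    the sites next to the ends of the cell are continuum sites, which is where
    K <= N - 2 enters. *)
Lemma Eqce_bonds (phi : R -> R) N K (y : int -> R) :
  (K + 2 <= N)%N -> strain_periodic N y ->
  let p := dq N y in
  Eqce phi N K y = eps R N * \sum_(l <- cell N)
    (phi (p l) + cont_weight K l * phi (2 * p l)
     + atom_weight K l * phi (p l + p (l + 1))).
Proof.
move=> KN yper p.
have pend : p (N%:Z + 1) = p (1 - N%:Z).
  by rewrite -[RHS](yper (1 - N%:Z)); congr (dq N y _); lia.
(* The site energy at l minus the bond energy at l is T (l + 1) - T l. *)
pose G l := phi (p l + p (l + 1)).
pose T l := 2^-1 * (phi (p l) + (1 - core K (l - 1)) * phi (2 * p l)
                    - core K l * G (l - 1) + core K (l - 1) * G l).
rewrite /Eqce -mulrDr; congr (_ * _); rewrite big_mkcond /=.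
rewrite [X in _ + X]big_mkcond /= -big_split /=.
apply/eqP; rewrite -subr_eq0 -sumrB.
rewrite (eq_bigr (fun l => T (l + 1) - T l)) => [|l _]; last first.
  rewrite /T /G /Eatom /Econt /cont_weight /atom_weight -/p /core.
  rewrite addrK subrK -(addrA l 1 1).
  by case: leqP => _ /=; field.
rewrite cell_telescope /T /G pend !core_out; [|lia..].
by rewrite subr0 !mul0r subrr.
Qed.

End Cell.


(** * Second variation of the energy *)

Section Variation.
Variables (R : realType) (phi : R -> R).
Hypothesis phiC4 : C4_pos phi.
Implicit Types (N K k : nat) (l : int) (y u : int -> R).

Lemma is_derive_phi k (r : R) : (k < 4)%N -> 0 < r ->
  is_derive r (1 : R) (phi^`(k)%classic) (phi^`(k.+1)%classic r).
Proof.
move=> k4 r0; rewrite derive1nS derive1E; apply: derivableP.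
by have [+ _] := phiC4 r0; apply.
Qed.

Lemma is_derive_phi_line k (a b c : R) : (k < 4)%N -> 0 < a ->
  is_derive (0 : R) (1 : R) (fun t => c * (phi^`(k)%classic (a + t * b) * b ^+ k))
    (c * (phi^`(k.+1)%classic a * b ^+ k.+1)).
Proof.
move=> k4 a0.
have lin : is_derive (0 : R) (1 : R) (fun t : R => a + t * b) b.
  have -> : (fun t : R => a + t * b) = cst a + b \*: id.
    by apply/funext => t; rewrite !fctE /= mulrC.
  have h := is_deriveD (is_derive_cst a (0 : R) (1 : R))
    (is_deriveZ b (is_derive_id (0 : R) (1 : R))).
  by move: h; rewrite add0r /GRing.scale /= mulr1.
have a0' : 0 < a + 0 * b by rewrite mul0r addr0.
have dphi := @is_derive1_comp _ (phi^`(k)%classic) (fun t : R => a + t * b) _ _ _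
  (is_derive_phi k4 a0') lin.
have := is_deriveZ (c * b ^+ k) dphi.
set f := (X in is_derive _ _ X _); set g := (X in _ -> is_derive _ _ X _).
have -> : f = g by apply/funext => t; rewrite /f /g /=/GRing.scale/=; ring.
move=> h; apply: (is_derive_eq h).
by rewrite mul0r addr0 /GRing.scale/= exprS; ring.
Qed.

Lemma is_derive_sum_seq (I : Type) (s : seq I) (f : I -> R -> R) (df : I -> R) (t : R) :
  (forall i, is_derive t (1 : R) (f i) (df i)) ->
  is_derive t (1 : R) (fun x => \sum_(i <- s) f i x) (\sum_(i <- s) df i).
Proof.
move=> fd; elim: s => [|i s IH].
  rewrite big_nil; have -> : (fun x => \sum_(i <- [::]) f i x) = cst 0.
    by apply/funext => x; rewrite big_nil.
  exact: is_derive_cst.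
rewrite big_cons.
have -> : (fun x => \sum_(i <- i :: s) f i x) = f i + (fun x => \sum_(i <- s) f i x).
  by apply/funext => x; rewrite big_cons.
exact: is_deriveD.
Qed.

Lemma dq_line N y u (t : R) l :
  dq N (fun l => y l + t * u l) l = dq N y l + t * dq N u l.
Proof. by rewrite /dq; ring. Qed.

Lemma strain_periodic_line N y u (t : R) :
  strain_periodic N y -> strain_periodic N u ->
  strain_periodic N (fun l => y l + t * u l).
Proof. by move=> yper uper l; rewrite !dq_line yper uper. Qed.

(** The k-th variation of the bond form of the energy, all k directions being u. *)
Definition bond_variation k N K y u : R :=
  let p := dq N y in let q := dq N u in
  eps R N * \sum_(l <- cell N)
    (phi^`(k)%classic (p l) * q l ^+ k
     + cont_weight R K l * (phi^`(k)%classic (2 * p l) * (2 * q l) ^+ k)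
     + atom_weight R K l *
       (phi^`(k)%classic (p l + p (l + 1)) * (q l + q (l + 1)) ^+ k)).

Lemma is_derive_bond_variation k N K y u : (k < 4)%N -> (forall l, 0 < dq N y l) ->
  is_derive (0 : R) (1 : R)
    (fun t => bond_variation k N K (fun l => y l + t * u l) u)
    (bond_variation k.+1 N K y u).
Proof.
move=> k4 ypos; rewrite /bond_variation.
apply: (@is_deriveZ _ _ _ (fun t => \sum_(l <- cell N) _) (eps R N)).
apply: is_derive_sum_seq => l.
have p0 := ypos l; have p1 := ypos (l + 1).
set p := dq N y l in p0 *; set p' := dq N y (l + 1) in p1 *.
set q := dq N u l; set q' := dq N u (l + 1).
have := is_deriveD (is_deriveD
  (is_derive_phi_line q 1 k4 p0)
  (@is_derive_phi_line k (2 * p) (2 * q) (cont_weight R K l) k4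
     (mulr_gt0 (ltr0n _ 2) p0)))
  (@is_derive_phi_line k (p + p') (q + q') (atom_weight R K l) k4 (addr_gt0 p0 p1)).
set f := (X in is_derive _ _ X _); set g := (X in _ -> is_derive _ _ X _).
have -> : f = g.
  apply/funext => t; rewrite /f /g /= !dq_line -/p -/p' -/q -/q' !fctE mul1r.
  congr (_ + _ * (phi^`(k)%classic _ * _) + _ * (phi^`(k)%classic _ * _)); ring.
by rewrite mul1r.
Qed.

(** Positivity of all the strains is an open condition along a line because
    periodicity leaves only finitely many of them. *)
Lemma strain_near_gt0 N y u : (0 < N)%N ->
  strain_periodic N y -> strain_periodic N u -> (forall l, 0 < dq N y l) ->
  \forall t \near (0 : R), forall l, 0 < dq N (fun l => y l + t * u l) l.
Proof.
move=> N0 yper uper ypos.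
have nearall (s : seq int) :
    \forall t \near (0 : R), all (fun l => 0 < dq N y l + t * dq N u l) s.
  elim: s => [|l s IH]; first by apply: filterE.
  have near1 : \forall t \near (0 : R), 0 < dq N y l + t * dq N u l.
    have lin : continuous (fun t : R => dq N y l + t * dq N u l).
      by move=> t; apply: cvgD; [exact: cvg_cst|apply: cvgMl; exact: cvg_id].
    by apply: (cvgr_gt _ (lin 0)); rewrite mul0r addr0.
  by near=> t; rewrite /=; apply/andP; split; near: t.
near=> t.
have /allP tpos : all (fun l => 0 < dq N y l + t * dq N u l) (cell N).
  by near: t; exact: nearall.
apply: (@periodicP N _ (dq N (fun l => y l + t * u l)) N0 _ (fun x => 0 < x)).
  exact: strain_periodic_line.
by move=> l /tpos; rewrite dq_line.
Unshelve. all: end_near. Qed.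

Lemma dEqceE N K y u : (K + 2 <= N)%N ->
  strain_periodic N y -> strain_periodic N u -> (forall l, 0 < dq N y l) ->
  dEqce phi N K y u = bond_variation 1 N K y u.
Proof.
move=> KN yper uper ypos; rewrite /dEqce derive1E.
have -> : (fun t : R => Eqce phi N K (fun l => y l + t * u l))
        = (fun t : R => bond_variation 0 N K (fun l => y l + t * u l) u).
  apply/funext => t; rewrite Eqce_bonds //; last exact: strain_periodic_line.
  by congr (_ * _); apply: eq_bigr => l _; rewrite derive1n0 !expr0 !mulr1.
by have h := @is_derive_bond_variation 0 N K y u isT ypos; exact: derive_val.
Qed.

(** The first variation has its bond form only at positive strains, where phi is
    differentiable.  Near y the strains remain positive, and the second variation
    depends on nothing more. *)
Lemma ddEqceE N K y u : (K + 2 <= N)%N ->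
  strain_periodic N y -> strain_periodic N u -> (forall l, 0 < dq N y l) ->
  ddEqce phi N K y u u = bond_variation 2 N K y u.
Proof.
move=> KN yper uper ypos; rewrite /ddEqce derive1E.
have h := @is_derive_bond_variation 1 N K y u isT ypos.
rewrite -[RHS](derive_val (is_derive := h)); apply: near_eq_derive.
have N0 : (0 < N)%N by lia.
apply: filterS (strain_near_gt0 N0 yper uper ypos) => t tpos.
by apply: dEqceE => //; exact: strain_periodic_line.
Qed.

End Variation.


(** * Taylor estimate *)

Section Taylor.
Variable R : realType.

Lemma mvt_le (f df : R -> R) (a b B : R) : a < b ->
  (forall z, a <= z <= b -> is_derive z (1 : R) f (df z) /\ `|df z| <= B) ->
  `|f b - f a| <= B * (b - a).
Proof.
move=> ab H.
have df_ab z : z \in `]a, b[ -> is_derive z 1 f (df z).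
  by rewrite in_itv /= => /andP[/ltW az /ltW zb]; apply: (H z _).1; rewrite az.
have [|c] := MVT ab df_ab.
  apply: derivable_within_continuous => z; rewrite in_itv /= => zab.
  by have [[]] := H z zab.
rewrite in_itv /= => /andP[/ltW ac /ltW cb] ->.
rewrite normrM (gtr0_norm (_ : 0 < b - a)) ?subr_gt0 //.
by apply: ler_wpM2r; [rewrite subr_ge0 ltW|apply: (H c _).2; rewrite ac].
Qed.

Lemma mvt_abs (f df : R -> R) (a x B : R) :
  (forall z, `|z - a| <= `|x - a| -> is_derive z (1 : R) f (df z) /\ `|df z| <= B) ->
  `|f x - f a| <= B * `|x - a|.
Proof.
move=> H; have [ax|xa|<-] := ltgtP a x; last by rewrite !subrr normr0 mulr0.
  rewrite (gtr0_norm (_ : 0 < x - a)) ?subr_gt0 //; apply: mvt_le => // z /andP[az zx].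
  by apply: H; rewrite !ger0_norm ?subr_ge0 ?lerD2r // ltW.
rewrite (distrC (f x)) (distrC x) (gtr0_norm (_ : 0 < a - x)) ?subr_gt0 //.
apply: mvt_le => // z /andP[xz za].
by apply: H; rewrite !ler0_norm ?subr_le0 ?lerN2 ?lerD2r // ltW.
Qed.

(** The mean value bound is used for df, then for f minus its tangent at a; this
    loses a factor 1/2 in the constant. *)
Lemma taylor_abs (f df ddf : R -> R) (a h B : R) :
  (forall z, `|z - a| <= `|h| ->
     [/\ is_derive z (1 : R) f (df z), is_derive z (1 : R) df (ddf z)
       & `|ddf z| <= B]) ->
  `|f (a + h) - f a - df a * h| <= B * h ^+ 2.
Proof.
move=> H; have [_ _ B0] := H a ltac:(by rewrite subrr normr0 normr_ge0).
pose g z := f z - df a * z.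
have -> : f (a + h) - f a - df a * h = g (a + h) - g a by rewrite /g; ring.
have ahK : a + h - a = h by ring.
have -> : B * h ^+ 2 = B * `|h| * `|a + h - a|.
  by rewrite ahK -mulrA -expr2 real_normK ?num_real.
apply: (@mvt_abs _ (fun z => df z - df a)) => z; rewrite ahK => zh.
have [fz _ _] := H z zh; split.
  have -> : g = f - df a \*: id by apply/funext.
  have h' := is_deriveB fz (is_deriveZ (df a) (is_derive_id z (1 : R))).
  by move: h'; rewrite /GRing.scale /= mulr1.
have Bz : `|df z - df a| <= B * `|z - a|.
  apply: (@mvt_abs _ ddf) => w wz.
  by have [_ ? ?] := H w (le_trans wz zh).
by apply: (le_trans Bz); apply: ler_wpM2l => //; apply: le_trans B0.
Qed.

End Taylor.

(** * Test directions *)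

Section TestFunction.
Variable R : realType.
Implicit Types (N K m : nat) (l : int).

(** The 2N-periodic extension of the indicator of the sites l with |l| < m, which
    the shift by m - 1 maps to the residues 0, ..., 2m - 2. *)
Definition plateau N m l : R :=
  (((l + m%:Z - 1)%R %% N.*2%:Z)%Z < m.*2%:Z - 1)%R%:R.

Lemma plateau_periodic N m l : plateau N m (l + N.*2%:Z) = plateau N m l.
Proof.
rewrite /plateau; have -> : l + N.*2%:Z + m%:Z - 1 = l + m%:Z - 1 + N.*2%:Z by ring.
by rewrite modzDr.
Qed.

Lemma plateauE N m l : (0 < m <= N)%N -> - N%:Z <= l <= N%:Z ->
  plateau N m l = (1 - m%:Z <= l < m%:Z)%R%:R.
Proof.
move=> mN lN; rewrite /plateau; congr (nat_of_bool _)%:R.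
have [l0|l0] := lerP (1 - m%:Z) l.
  by rewrite modz_small; lia.
by rewrite -modzDr modz_small; lia.
Qed.

(** The factor sqrt (N / 2) is the strain of the two strained bonds that gives
    unit norm; the factor eps cancels that of the difference quotient. *)
Definition test_function N m : int -> R :=
  let mean := (\sum_(l <- cell N) plateau N m l) / N.*2%:R in
  fun l => Num.sqrt (N%:R / 2) * eps R N * (plateau N m l - mean).

Lemma dq_test_function N m l : (0 < m <= N)%N -> l \in cell N ->
  dq N (test_function N m) l
  = Num.sqrt (N%:R / 2) * ((l == 1 - m%:Z)%R%:R - (l == m%:Z)%R%:R).
Proof.
move=> mN; rewrite mem_cell => lN.
have N0 : (N%:R : R) != 0 by rewrite pnatr_eq0; lia.
transitivity (Num.sqrt (N%:R / 2) * (plateau N m l - plateau N m (l - 1))).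
  by rewrite /dq /test_function /eps /=; set mean := _ / N.*2%:R; field.
rewrite !plateauE; [|lia..]; congr (_ * _).
have [->|ne1] := eqVneq l (1 - m%:Z).
  have -> : 1 - m%:Z == m%:Z = false by lia.
  have -> : (1 - m%:Z <= 1 - m%:Z < m%:Z) by lia.
  by have -> : (1 - m%:Z <= 1 - m%:Z - 1 < m%:Z) = false by lia.
have [->|ne2] := eqVneq l m%:Z.
  have -> : (1 - m%:Z <= m%:Z < m%:Z) = false by lia.
  by have -> : (1 - m%:Z <= m%:Z - 1 < m%:Z) by lia.
have -> : (1 - m%:Z <= l - 1 < m%:Z) = (1 - m%:Z <= l < m%:Z).
  by apply/idP/idP; lia.
by rewrite !subrr.
Qed.

Lemma test_function_Uspace N m : (0 < N)%N -> Uspace N (test_function N m).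
Proof.
move=> N0; split => [l|]; first by rewrite /test_function plateau_periodic.
rewrite -mulr_sumr sumrB big_const_seq count_predT size_map size_iota iter_addr addr0.
rewrite -[X in _ - X]mulr_natr divfK ?subrr ?mulr0 // pnatr_eq0; lia.
Qed.

Lemma Uspace_strain_periodic N (u : int -> R) : Uspace N u -> strain_periodic N u.
Proof. by move=> [uper _] l; rewrite /dq uper addrAC uper. Qed.

(** At each of the two strained bonds eps q^2 = 1/2. *)
Lemma sum_test_strain N m (w : int -> R) : (0 < m <= N)%N ->
  eps R N * \sum_(l <- cell N) w l * dq N (test_function N m) l ^+ 2
  = 2^-1 * (w (1 - m%:Z) + w m%:Z).
Proof.
move=> mN; have N0 : (N%:R : R) != 0 by rewrite pnatr_eq0; lia.
rewrite big_seq (eq_bigr (fun l => N%:R / 2 * ((if l == 1 - m%:Z then w l else 0)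
    + (if l == m%:Z then w l else 0)))) => [|l lN]; last first.
  rewrite dq_test_function // exprMn sqr_sqrtr ?divr_ge0 //.
  have [->|ne1] := eqVneq l (1 - m%:Z).
    have -> : (1 - m%:Z == m%:Z) = false by lia.
    by rewrite /=; ring.
  by case: (l == m%:Z) => /=; ring.
rewrite -big_seq -mulr_sumr big_split /= -!big_mkcond.
have pick a : a \in cell N -> \sum_(l <- cell N | l == a) w l = w a.
  move=> aN; rewrite -big_filter; have /= := filter_pred1_uniq (cell_uniq N) aN.
  by move=> ->; rewrite big_seq1.
rewrite !pick ?mem_cell; [|lia..].
by rewrite /eps; field; rewrite N0.
Qed.

Lemma l2norm_test_function N m : (0 < m <= N)%N ->
  l2norm N (dq N (test_function N m)) = 1.
Proof.
move=> mN; rewrite /l2norm (eq_bigr (fun l => 1 * dq N (test_function N m) l ^+ 2)).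
  by rewrite (sum_test_strain (fun=> 1)) // (_ : 2^-1 * (1 + 1) = 1) ?sqrtr1 //; field.
by move=> l _; rewrite mul1r real_normK // num_real.
Qed.

(** Coefficient of phi''(2F) in the diagonal entry of bond l: the factor 4 is the
    square of the 2 in phi (2 y'_l), and bond l belongs to the two pairs (l, l+1)
    and (l-1, l). *)
Definition second_neighbour_weight K l : R :=
  4 * cont_weight R K l + atom_weight R K l + atom_weight R K (l - 1).

(** The cross terms vanish, and the square of the second strain of each pair is
    moved to the next bond by summation by parts, without boundary terms since
    the ends of the cell are continuum. *)
Lemma sum_pair_strain N K (q : int -> R) : (K + 2 <= N)%N ->
  (forall l, l \in cell N -> atom_weight R K l * (q l * q (l + 1)) = 0) ->
  \sum_(l <- cell N) atom_weight R K l * (q l + q (l + 1)) ^+ 2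
  = \sum_(l <- cell N) (atom_weight R K l + atom_weight R K (l - 1)) * q l ^+ 2.
Proof.
move=> KN q0; apply/eqP; rewrite -subr_eq0 -sumrB.
pose T l := atom_weight R K (l - 1) * q l ^+ 2.
rewrite big_seq (eq_bigr (fun l => T (l + 1) - T l)) => [|l lN]; last first.
  have := q0 l lN; rewrite /T addrK => {}q0.
  transitivity (2 * (atom_weight R K l * (q l * q (l + 1)))
    + (atom_weight R K l * q (l + 1) ^+ 2 - atom_weight R K (l - 1) * q l ^+ 2)).
    by ring.
  by rewrite q0 mulr0 add0r.
rewrite -big_seq cell_telescope /T /atom_weight !core_out; [|lia..].
by rewrite addr0 mulr0 !mul0r subrr.
Qed.

Lemma core_ge0 K l : 0 <= core R K l <= 1.
Proof. by rewrite /core; case: (_ <= _)%N; rewrite ?lexx ?ler01. Qed.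

Lemma cont_weight_ge0 K l : 0 <= cont_weight R K l.
Proof.
rewrite /cont_weight; have := core_ge0 K l; have := core_ge0 K (l - 1).
by move=> /andP[_ h] /andP[_ h']; lra.
Qed.

Lemma atom_weight_ge0 K l : 0 <= atom_weight R K l.
Proof.
rewrite /atom_weight; have := core_ge0 K (l + 1); have := core_ge0 K (l - 1).
by move=> /andP[h _] /andP[h' _]; lra.
Qed.

(** The strained bonds 1-m and m interact only if they are adjacent.  Within the
    cell this needs m = 1; across its ends it needs m = N, where the pair weight
    vanishes. *)
Lemma bond_variation_test_le (phi : R -> R) N K m (y : int -> R) (A : int -> R) (B : R) :
  (1 < K)%N -> (K + 2 <= N)%N -> (1 < m <= N)%N ->
  (forall l, l \in cell N -> phi^`(2)%classic (dq N y l) <= A l) ->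
  (forall l, phi^`(2)%classic (2 * dq N y l) <= B) ->
  (forall l, phi^`(2)%classic (dq N y l + dq N y (l + 1)) <= B) ->
  bond_variation phi 2 N K y (test_function N m)
  <= 2^-1 * (A (1 - m%:Z) + second_neighbour_weight K (1 - m%:Z) * B
             + (A m%:Z + second_neighbour_weight K m%:Z * B)).
Proof.
move=> K1 KN mN hA hB hB'.
have m0N : (0 < m <= N)%N by lia.
rewrite -(@sum_test_strain N m (fun l => A l + second_neighbour_weight K l * B)) //.
rewrite /bond_variation; set q := dq N (test_function N m).
apply: ler_wpM2l; first by rewrite invr_ge0.
apply: (@le_trans _ _ (\sum_(l <- cell N)
   ((A l + 4 * cont_weight R K l * B) * q l ^+ 2
    + B * (atom_weight R K l * (q l + q (l + 1)) ^+ 2)))).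
  rewrite big_seq [leRHS]big_seq; apply: ler_sum => l lN.
  rewrite [X in _ <= X + _]mulrDl; apply: lerD; last first.
    rewrite [leRHS]mulrCA; apply: ler_wpM2l; first exact: atom_weight_ge0.
    by apply: ler_wpM2r; rewrite ?sqr_ge0.
  apply: lerD; first by apply: ler_wpM2r; rewrite ?sqr_ge0 ?hA.
  rewrite (_ : _ * q l ^+ 2 = cont_weight R K l * (B * (2 * q l) ^+ 2)); last by ring.
  apply: ler_wpM2l; first exact: cont_weight_ge0.
  by apply: ler_wpM2r; rewrite ?sqr_ge0.
rewrite big_split /= -mulr_sumr sum_pair_strain // => [|l lN].
  rewrite mulr_sumr -big_split /= ler_sum // => l _.
  by rewrite /second_neighbour_weight le_eqVlt; apply/orP; left; apply/eqP; ring.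
have [->|lltN] := eqVneq l N%:Z.
  by rewrite /atom_weight !core_out; [rewrite addr0 mulr0 mul0r|lia..].
rewrite mem_cell in lN.
rewrite /q !dq_test_function ?mem_cell; [|lia..].
have [->|_] := eqVneq l (1 - m%:Z).
  have -> : 1 - m%:Z == m%:Z = false by lia.
  have -> : 1 - m%:Z + 1 == 1 - m%:Z = false by lia.
  have -> : 1 - m%:Z + 1 == m%:Z = false by lia.
  by rewrite subrr !mulr0.
have [->|_] := eqVneq l m%:Z; last by rewrite subrr mulr0 mul0r mulr0.
have -> : m%:Z + 1 == 1 - m%:Z = false by lia.
have -> : m%:Z + 1 == m%:Z = false by lia.
by rewrite subrr !mulr0.
Qed.

End TestFunction.

(** * Second-neighbour weights of the strained bonds *)

Ltac eval_core K := repeat match goal with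
  |- context [core ?R K ?l] =>
    first [rewrite (@core_in R K l); [|lia] | rewrite (@core_out R K l); [|lia]]
  end.

Section Weights.
Variables (R : realType) (N K : nat).
Hypotheses (K1 : (1 < K)%N) (KN : (K + 2 <= N)%N).

Lemma weight_inner :
  second_neighbour_weight R K (1 - K%:Z) = 3 / 2
  /\ second_neighbour_weight R K K%:Z = 3 / 2.
Proof.
by rewrite /second_neighbour_weight /cont_weight /atom_weight; eval_core K; split; field.
Qed.

Lemma weight_outer :
  second_neighbour_weight R K (1 - (K + 2)%N%:Z) = 9 / 2
  /\ second_neighbour_weight R K (K + 2)%N%:Z = 9 / 2.
Proof.
by rewrite /second_neighbour_weight /cont_weight /atom_weight; eval_core K; split; field.
Qed.

Lemma weight_far : (K + 2 < N)%N ->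
  second_neighbour_weight R K (1 - N%:Z) = 4 /\ second_neighbour_weight R K N%:Z = 4.
Proof.
move=> KN2.
by rewrite /second_neighbour_weight /cont_weight /atom_weight; eval_core K; split; field.
Qed.

End Weights.

(** * Estimates at the equilibrium *)

Lemma sqr_le_of_norm (R : realType) (x b : R) : `|x| <= b -> x ^+ 2 <= b ^+ 2.
Proof.
move=> xb; rewrite -[x ^+ 2]real_normK ?num_real // lerXn2r // nnegrE //.
exact: le_trans xb.
Qed.

Lemma le_of_taylor (R : realType) (x a b t q s : R) :
  x - a - b <= t -> t <= q -> b <= s -> x <= a + (s + q).
Proof. lra. Qed.

(** Collects the error terms of phi2_bond_le and phi2_pair_le.  The factor 6 is an
    upper bound of 1 + n, as n is at most 9/2. *)
Lemma collect_remainders (R : realType) (f b e x D M c n : R) :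
  0 < f -> 0 <= M -> 0 <= c -> 0 <= D -> n <= 9 / 2 ->
  let bond := f * (1 + b + (2 * M * c + M * D ^+ 2) * x ^+ 2) in
  let pair := n * (f * (- e + (2 * D + 4 * M * D ^+ 2) * x ^+ 2)) in
  2^-1 * (bond + pair + (bond + pair))
  <= f * (1 + b - n * e + 6 * (2 * M * c + 2 * D + 4 * M * D ^+ 2) * x ^+ 2).
Proof.
move=> f0 M0 c0 D0 n9 /=; set r := 2 * (D * x ^+ 2) + 4 * (M * D ^+ 2 * x ^+ 2).
have x0 := sqr_ge0 x; have D2 := sqr_ge0 D.
have a1 : 0 <= M * c * x ^+ 2 by apply: mulr_ge0 => //; exact: mulr_ge0.
have a2 : 0 <= D * x ^+ 2 by exact: mulr_ge0.
have a3 : 0 <= M * D ^+ 2 * x ^+ 2 by apply: mulr_ge0 => //; exact: mulr_ge0.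
have nr : n * r <= 9 / 2 * r by apply: ler_wpM2r => //; rewrite /r; lra.
rewrite (_ : 2^-1 * _ = f * (1 + b - n * e
    + (2 * (M * c * x ^+ 2) + M * D ^+ 2 * x ^+ 2 + n * r))); last by rewrite /r; field.
rewrite ler_pM2l // lerD2l.
rewrite [leRHS](_ : _ = 6 * (2 * (M * c * x ^+ 2) + r)); last by rewrite /r; ring.
by rewrite /r in nr *; lra.
Qed.

(** If delta <= 1, all strains are within (1/2 + 2 |C|) delta of F.  The second
    part of the threshold makes this at most F / 2, so that the strains stay above
    F / 2, where the derivatives of phi are controlled. *)
Definition delta_threshold (R : realType) (F C : R) : R :=
  Num.min 1 (F / (2 * (1 / 2 + 2 * `|C|))).

Definition remainder_constant (R : realType) (M C : R) : R :=
  6 * (2 * M * `|C| + 2 * (1 / 2 + 2 * `|C|) + 4 * M * (1 / 2 + 2 * `|C|) ^+ 2).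

Section Estimates.
Variables (R : realType) (phi : R -> R) (F M C rstar : R).
Hypotheses (F_gt0 : 0 < F) (adm : admissible phi rstar F)
  (bnd : derivatives_bounded_by phi M F).

Let D : R := 1 / 2 + 2 * `|C|.
Local Notation d := (delta phi F).
Local Notation phi2F := (phi^`(2)%classic F).

Lemma phi2F_gt0 : 0 < phi2F.
Proof. by have [] := adm. Qed.

Lemma half_F_le : F / 2 <= F.
Proof. by have := F_gt0; lra. Qed.

Lemma M_ge0 : 0 <= M.
Proof.
have := bnd (isT : (2 <= 4)%N) half_F_le; rewrite gtr0_norm ?phi2F_gt0 //.
by have := phi2F_gt0 => f0; rewrite -{1}[phi2F]mul1r ler_pM2r // => /(le_trans ler01).
Qed.

Lemma delta_bounds :
  [/\ `|delta1 phi F| <= d, `|delta2 phi F| <= d, `|delta3 phi F| <= d & 0 <= d].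
Proof.
have d1 : `|delta1 phi F| <= d by rewrite /delta !le_max lexx.
split => //; last exact: le_trans d1.
  by rewrite /delta !le_max lexx orbT.
by rewrite /delta !le_max lexx orbT.
Qed.

Lemma phi1_2F : phi^`(1)%classic (2 * F) = phi2F * delta1 phi F.
Proof. by apply: esym; rewrite /delta1 mulrC divfK // gt_eqF // phi2F_gt0. Qed.

Lemma phi2_2F : phi^`(2)%classic (2 * F) = phi2F * - delta2 phi F.
Proof.
by apply: esym; rewrite /delta2 mulrN mulrC divfK ?opprK // gt_eqF // phi2F_gt0.
Qed.

Lemma phi3_2F : phi^`(3)%classic (2 * F) = phi2F * delta3 phi F.
Proof. by apply: esym; rewrite /delta3 mulrC divfK // gt_eqF // phi2F_gt0. Qed.

Lemma phi2_taylor (a h : R) : F / 2 <= a - `|h| ->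
  `|phi^`(2)%classic (a + h) - phi^`(2)%classic a - phi^`(3)%classic a * h|
  <= M * phi2F * h ^+ 2.
Proof.
move=> ah; have [[C4 _ _ _ _] _ _ _] := adm.
apply: (@taylor_abs _ _ _ (phi^`(4)%classic)) => z /ler_normlP[za _].
have zF : F / 2 <= z by lra.
have z0 : 0 < z by apply: lt_le_trans zF; rewrite divr_gt0.
by split; [exact: is_derive_phi|exact: is_derive_phi|exact: bnd].
Qed.

Variables (N K : nat) (ghat y : int -> R).
Hypotheses (K1 : (1 < K)%N) (KN : (K + 2 <= N)%N) (hg : is_ghat N K ghat)
  (hy : is_yqce phi F N K C ghat y) (hd : d <= delta_threshold F C).

Let N0 : (0 < N)%N. Proof. by lia. Qed.

Lemma dq_yhom (u : int -> R) l : dq N (fun l => yhom F N l + u l) l = F + dq N u l.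
Proof.
rewrite /dq /yhom /eps rmorphB /=; field.
by rewrite pnatr_eq0; lia.
Qed.

Lemma yqce_periodic : strain_periodic N y.
Proof.
have [[u /Uspace_strain_periodic uper yE] _ _ _] := hy.
have -> : y = fun l => yhom F N l + u l by apply/funext.
by move=> l; rewrite !dq_yhom uper.
Qed.

Lemma D_ge : 1 / 2 <= D.
Proof. by rewrite /D; have := normr_ge0 C; lra. Qed.

Lemma delta_small : d <= 1 /\ D * d <= F / 2.
Proof.
have := hd; rewrite /delta_threshold le_min => /andP[-> h]; split => //.
have D0 := D_ge; rewrite -/D ler_pdivlMr in h; last by lra.
lra.
Qed.

Lemma yqce_strain l : l \in cell N ->
  `|dq N y l - F - delta1 phi F * dq N ghat l| <= 2 * `|C| * d ^+ 2.
Proof.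
move=> lN; have [_ _ _ hinf] := hy; have [d1 d2 _ d0] := delta_bounds.
have -> : dq N y l - F - delta1 phi F * dq N ghat l
        = dq N (fun l => y l - yhat_qce phi F N ghat l) l.
  have -> : dq N (fun l => y l - yhat_qce phi F N ghat l) l
     = dq N y l - dq N (fun l => yhom F N l + delta1 phi F * ghat l) l.
    by rewrite /yhat_qce /dq; ring.
  by rewrite dq_yhom [dq N (fun l => _ * _) l]/dq [dq N ghat l]/dq; ring.
apply: (@le_trans _ _ (linfnorm N (dq N (fun l => y l - yhat_qce phi F N ghat l)))).
  exact: (le_bigmax_seq 0 l xpredT
    (fun i => `|dq N (fun l => y l - yhat_qce phi F N ghat l) i|) lN).
apply: (le_trans hinf); apply: (le_trans (ler_norm _)).
rewrite normrM [leRHS](_ : _ = `|C| * (d * d + d * d)); last by ring.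
apply: ler_wpM2l => //; apply: (le_trans (ler_normD _ _)).
by rewrite expr2 !(normrM (delta1 phi F)); apply: lerD; apply: ler_pM.
Qed.

Lemma ghat_strain l : l \in cell N -> `|dq N ghat l| <= 1 / 2.
Proof.
move=> lN; have [_ ->] := hg; last by [].
case: ifP => _; first by rewrite normrN gtr0_norm //; lra.
by case: ifP => _; rewrite ?normr0 ?gtr0_norm //; lra.
Qed.

Lemma yqce_strain_F l : `|dq N y l - F| <= D * d.
Proof.
apply: (@periodicP N _ (dq N y) N0 yqce_periodic (fun x => `|x - F| <= D * d)).
move=> {}l lN; have [d1 _ _ d0] := delta_bounds; have [dle1 _] := delta_small.
have h := yqce_strain lN; have g := ghat_strain lN.
rewrite -[dq N y l - F](subrK (delta1 phi F * dq N ghat l)).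
apply: (le_trans (ler_normD _ _)); rewrite /D mulrDl addrC.
apply: lerD; first by rewrite normrM mulrC; apply: ler_pM.
apply: (le_trans h); rewrite expr2 mulrA ler_piMr //.
by rewrite !mulr_ge0.
Qed.

(** The deviation of the strain from F has a part delta1 ghat' of first order,
    kept in the bound, and a part of second order, which becomes an error. *)
Lemma phi2_bond_le l : l \in cell N ->
  phi^`(2)%classic (dq N y l)
  <= phi2F * (1 + phi^`(3)%classic F / phi2F * delta1 phi F * dq N ghat l
              + (2 * M * `|C| + M * D ^+ 2) * d ^+ 2).
Proof.
move=> lN; have f0 := phi2F_gt0; have M0 := M_ge0.
have [_ Dd] := delta_small; have [_ _ _ d0] := delta_bounds.
have hD := yqce_strain_F l; have wC := yqce_strain lN.
have [h hE] : exists h, h = dq N y l - F by exists (dq N y l - F).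
have [w wE] : exists w, w = h - delta1 phi F * dq N ghat l.
  by exists (h - delta1 phi F * dq N ghat l).
rewrite -hE in hD wC; rewrite -wE in wC.
have /phi2_taylor : F / 2 <= F - `|h| by lra.
have -> : F + h = dq N y l by rewrite hE addrC subrK.
move=> /ler_normlP[_ T].
have h2 : h ^+ 2 <= D ^+ 2 * d ^+ 2.
  by rewrite -exprMn; exact: sqr_le_of_norm.
have q2 : M * phi2F * h ^+ 2 <= M * phi2F * (D ^+ 2 * d ^+ 2).
  by apply: ler_wpM2l => //; rewrite mulr_ge0 // ltW.
have F3 : `|phi^`(3)%classic F| <= M * phi2F by apply: bnd => //; exact: half_F_le.
have lw : phi^`(3)%classic F * w <= M * phi2F * (2 * `|C| * d ^+ 2).
  by apply: (le_trans (ler_norm _)); rewrite normrM; apply: ler_pM.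
(* The rest is algebra in the quantities generalized here. *)
have hw : h = delta1 phi F * dq N ghat l + w by rewrite wE addrC subrK.
move: f0 T q2 lw hw; clear -M C; move: h w (dq N ghat l) (delta1 phi F) d D.
move: (phi^`(2)%classic (dq N y l)) phi2F (phi^`(3)%classic F).
move=> X f f3 h w g e x D' f0 T q2 lw hw.
have {hw} f3h : f3 * h = f3 * (e * g) + f3 * w by rewrite hw mulrDr.
rewrite (_ : f * _ = f + f3 * (e * g) + M * f * (2 * `|C| * x ^+ 2)
  + M * f * (D' ^+ 2 * x ^+ 2)); last by field; rewrite gt_eqF.
lra.
Qed.

(** The linear term of the expansion at 2F is phi'''(2F) h = phi''(F) delta3 h with
    h = O(delta), hence quadratic in delta. *)
Lemma phi2_pair_le (h : R) : `|h| <= 2 * (D * d) ->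
  phi^`(2)%classic (2 * F + h)
  <= phi2F * (- delta2 phi F + (2 * D + 4 * M * D ^+ 2) * d ^+ 2).
Proof.
move=> hD; have f0 := phi2F_gt0; have M0 := M_ge0.
have [_ Dd] := delta_small; have [_ _ d3 d0] := delta_bounds.
have /phi2_taylor/ler_normlP[_ T] : F / 2 <= 2 * F - `|h|.
  by have := F_gt0; lra.
have h2 : h ^+ 2 <= 4 * D ^+ 2 * d ^+ 2.
  rewrite (_ : 4 * D ^+ 2 * d ^+ 2 = (2 * (D * d)) ^+ 2); last by ring.
  exact: sqr_le_of_norm.
have q2 : M * phi2F * h ^+ 2 <= M * phi2F * (4 * D ^+ 2 * d ^+ 2).
  by apply: ler_wpM2l => //; rewrite mulr_ge0 // ltW.
have lw : delta3 phi F * h <= d * (2 * (D * d)).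
  by apply: (le_trans (ler_norm _)); rewrite normrM; apply: ler_pM.
have lw2 : phi^`(3)%classic (2 * F) * h <= phi2F * (2 * D * d ^+ 2).
  rewrite phi3_2F -mulrA ler_pM2l // (_ : 2 * D * d ^+ 2 = d * (2 * (D * d))) //.
  by move: d D => x D'; ring.
rewrite phi2_2F in T; rewrite mulrDr.
rewrite (_ : phi2F * ((2 * D + 4 * M * D ^+ 2) * d ^+ 2)
  = phi2F * (2 * D * d ^+ 2) + M * phi2F * (4 * D ^+ 2 * d ^+ 2)); last first.
  by move: phi2F d D => f x D'; ring.
exact: le_of_taylor T q2 lw2.
Qed.

(** The common form of the three bounds: gam is the strain of ghat on the two
    strained bonds of the test direction, n their second-neighbour weight. *)
Lemma coercivity_le_bond_pair m (gam n : R) : (1 < m <= N)%N -> n <= 9 / 2 ->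
  dq N ghat (1 - m%:Z) = gam /\ dq N ghat m%:Z = gam ->
  second_neighbour_weight R K (1 - m%:Z) = n /\ second_neighbour_weight R K m%:Z = n ->
  (qce_coercivity phi N K y
   <= (phi2F * (1 + phi^`(3)%classic F / phi2F * delta1 phi F * gam - n * delta2 phi F
                + remainder_constant M C * d ^+ 2))%:E)%E.
Proof.
move=> mN n9 [g1 g2] [n1 n2]; have m0N : (0 < m <= N)%N by lia.
have [[C4 _ _ _ _] _ _ _] := adm; have [_ ypos _ _] := hy.
have uU := @test_function_Uspace R N m N0.
set u := test_function R N m in uU *.
apply: ge_ereal_inf; exists (ddEqce phi N K y u u)%:E.
  by exists u => //; split => //; exact: l2norm_test_function.
rewrite lee_fin ddEqceE //; [|exact: yqce_periodic|exact: Uspace_strain_periodic].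
have near2F l : `|dq N y l - F| <= D * d := yqce_strain_F l.
apply: (le_trans (bond_variation_test_le K1 KN mN phi2_bond_le
   (B := phi2F * (- delta2 phi F + (2 * D + 4 * M * D ^+ 2) * d ^+ 2)) _ _)).
- move=> l; rewrite (_ : 2 * dq N y l = 2 * F + 2 * (dq N y l - F)); last by ring.
  by apply: phi2_pair_le; rewrite normrM gtr0_norm // ler_pM2l.
- move=> l; rewrite (_ : dq N y l + dq N y (l + 1)
    = 2 * F + ((dq N y l - F) + (dq N y (l + 1) - F))); last by ring.
  apply: phi2_pair_le; apply: (le_trans (ler_normD _ _)).
  by rewrite mulr2n mulrDl mul1r lerD.
rewrite g1 g2 n1 n2 /remainder_constant -/D.
apply: collect_remainders => //; [exact: phi2F_gt0|exact: M_ge0|].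
exact: le_trans D_ge.
Qed.

Lemma m_plusE :
  m_plus phi F = 1 + phi^`(3)%classic F / phi2F * delta1 phi F * (1 / 2)
                 - 3 / 2 * delta2 phi F.
Proof.
have f0 : phi2F != 0 by rewrite gt_eqF // phi2F_gt0.
rewrite /m_plus /m_corr phi2_2F phi1_2F gtr0_norm ?phi2F_gt0 //; move: f0.
by move: phi2F (phi^`(3)%classic F) (delta1 phi F) (delta2 phi F) => *; field.
Qed.

Lemma m_minusE :
  m_minus phi F = 1 + phi^`(3)%classic F / phi2F * delta1 phi F * - (1 / 2)
                  - 9 / 2 * delta2 phi F.
Proof.
have f0 : phi2F != 0 by rewrite gt_eqF // phi2F_gt0.
rewrite /m_minus /m_corr phi2_2F phi1_2F gtr0_norm ?phi2F_gt0 //; move: f0.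
by move: phi2F (phi^`(3)%classic F) (delta1 phi F) (delta2 phi F) => *; field.
Qed.

Lemma m_zeroE :
  m_zero phi F = 1 + phi^`(3)%classic F / phi2F * delta1 phi F * 0 - 4 * delta2 phi F.
Proof.
have f0 : phi2F != 0 by rewrite gt_eqF // phi2F_gt0.
rewrite /m_zero /AF phi2_2F mulr0 addr0; move: f0.
by move: phi2F (delta2 phi F) => *; field.
Qed.

Lemma coercivity_le_m_plus :
  (qce_coercivity phi N K y
   <= (phi2F * (m_plus phi F + remainder_constant M C * d ^+ 2))%:E)%E.
Proof.
rewrite m_plusE; apply: (@coercivity_le_bond_pair K); [lia|lra| |exact: weight_inner].
have [_ gE] := hg; rewrite !gE ?mem_cell ?inE; [|lia..].
split; (case: ifP => [|_]; [lia|]); (case: ifP => [_|]; [lra|lia]).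
Qed.

Lemma coercivity_le_m_minus :
  (qce_coercivity phi N K y
   <= (phi2F * (m_minus phi F + remainder_constant M C * d ^+ 2))%:E)%E.
Proof.
rewrite m_minusE; apply: (@coercivity_le_bond_pair (K + 2)%N).
- by lia.
- by [].
- have [_ gE] := hg; rewrite !gE ?mem_cell ?inE; [|lia..].
  by split; (case: ifP => [_|]; [lra|lia]).
- exact: weight_outer KN.
Qed.

Lemma coercivity_le_m_zero : (K + 2 < N)%N ->
  (qce_coercivity phi N K y
   <= (phi2F * (m_zero phi F + remainder_constant M C * d ^+ 2))%:E)%E.
Proof.
move=> KN2; rewrite m_zeroE; apply: (@coercivity_le_bond_pair N).
- by lia.
- by lra.
- have [_ gE] := hg; rewrite !gE ?mem_cell ?inE; [|lia..].
  by split; (case: ifP => [|_]; [lia|]); (case: ifP => [|_]; [lia|]).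
- exact: weight_far.
Qed.

Lemma m_eq1 : d = 0 -> [/\ m_plus phi F = 1, m_minus phi F = 1 & m_zero phi F = 1].
Proof.
have [d1 d2 _ _] := delta_bounds => d_eq0; rewrite d_eq0 !normr_le0 in d1 d2.
by rewrite m_plusE m_minusE m_zeroE (eqP d1) (eqP d2) !(mulr0, mul0r, subr0, addr0).
Qed.

End Estimates.

(** * The upper bound *)

(* Since delta is a function of phi and F, constants depending on phi without
   restriction would say nothing.  So dhat and Chat depend on phi only through
   a bound M on its derivatives; that is possible unless K + 2 = N, when there
   is no bond whose neighbouring atoms and second-neighbour interactions are
   all of continuum type and the constant cannot be uniform over phi, even for
   fixed N.  There (first conjunct) it depends on phi itself. *)
Theorem proposition6 (R : realType) (F M C : R) (F_gt0 : 0 < F) :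
  exists dhat Chat : R, 0 < dhat /\
  forall (phi : R -> R) (rstar : R),
    admissible phi rstar F ->
    derivatives_bounded_by phi M F ->
  exists Chat_phi : R,
  forall (N K : nat) (ghat yqce : int -> R),
    (1 < K)%N -> (K + 2 <= N)%N ->
    is_ghat N K ghat ->
    is_yqce phi F N K C ghat yqce ->
    delta phi F <= dhat ->
    let m := Num.min (Num.min (m_plus phi F) (m_minus phi F)) (m_zero phi F) in
    (qce_coercivity phi N K yqce
       <= (phi^`(2)%classic F * (m + Chat_phi * delta phi F ^+ 2))%:E)%E
    /\ ((K + 2 < N)%N ->
        (qce_coercivity phi N K yqce
           <= (phi^`(2)%classic F * (m + Chat * delta phi F ^+ 2))%:E)%E).
Proof.
have D0 : 0 < 1 / 2 + 2 * `|C| by have := normr_ge0 C; lra.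
exists (delta_threshold F C), (remainder_constant M C); split.
  by rewrite lt_min ltr01 divr_gt0 // mulr_gt0.
move=> phi rstar adm bnd.
set m := Num.min (Num.min (m_plus phi F) (m_minus phi F)) (m_zero phi F).
(* This value turns the first bound into the one given by m_plus; it is
   meaningful for delta = 0 as well, where m_plus = m. *)
exists (remainder_constant M C + (m_plus phi F - m) / delta phi F ^+ 2).
move=> N K ghat y K1 KN hg hy hd; rewrite -/m /=.
have hplus := coercivity_le_m_plus F_gt0 adm bnd K1 KN hg hy hd.
have hminus := coercivity_le_m_minus F_gt0 adm bnd K1 KN hg hy hd.
split=> [|KN2]; last first.
  have hzero := coercivity_le_m_zero F_gt0 adm bnd K1 KN hg hy hd KN2.
  by rewrite /m /Num.min; case: ifP => _; [case: ifP|].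
apply: (le_trans hplus); rewrite lee_fin le_eqVlt; apply/orP; left; apply/eqP.
congr (_ * _); have [d0|d0] := eqVneq (delta phi F) 0.
  have [p1 q1 z1] := m_eq1 adm d0.
  by rewrite /m p1 q1 z1 /Num.min !ltxx d0 expr0n /= !mulr0.
rewrite mulrDl divfK ?sqrf_eq0 //.
by rewrite addrCA (addrC m) subrK addrC.
Qed.
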